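(* Let $t\ge3$ be an integer and suppose there is a generalized quadrangle $GQ(t-2,t)$ that has a spread. Let $G$ be the graph obtained from the collinearity graph of this generalized quadrangle by removing the edges of the spread. Then $G$ is an antipodal distance-regular graph of diameter $3$ with exactly $3$ distinct distance eigenvalues. Moreover, there are infinitely many $t$ for which a $GQ(t-2,t)$ with a spread exists, so this gives an infinite family of distance-regular graphs of diameter $3$ with exactly $3$ distinct distance eigenvalues.
   Context: Graphs are finite, undirected and simple. A generalized quadrangle $GQ(s,t)$ is a point-line incidence structure in which each line has $s+1$ points, each point is on $t+1$ lines, two distinct points are on at most one common line, and for each point $p$ not on a line $L$ there is a unique point of $L$ collinear with $p$. Its collinearity graph has the points as vertices, two distinct points being adjacent when they are on a common line. A spread is a set of pairwise disjoint lines (vertex-disjoint $(s+1)$-cliques of the collinearity graph) covering all points; removing the spread means deleting all edges joining two points on the same line of the spread. A connected graph $G$ of diameter $D$ is distance-regular if there are numbers $a_i,b_i,c_i$ ($0\le i\le D$) such that for all vertices $x,y$ with $d(x,y)=i$, the number of neighbours of $y$ at distance $i-1$, $i$, $i+1$ from $x$ is $c_i$, $a_i$, $b_i$ respectively. $G$ is antipodal if $d(u,v)=d(u,w)=D$ implies $d(v,w)=D$ or $v=w$. The distance eigenvalues of $G$ are the eigenvalues of its distance matrix, whose $(x,y)$-entry is $d(x,y)$. *)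

(* Defs.v *)
From HB Require Import structures.
From mathcomp Require Import all_boot all_order all_algebra.

Set Implicit Arguments.
Unset Strict Implicit.
Unset Printing Implicit Defensive.

Import GRing.Theory Num.Theory.

Section Graphs.

Variables (T : finType) (e : rel T).

Definition simple_graph : Prop := symmetric e /\ irreflexive e.

Definition connected_graph : Prop := forall x y : T, connect e x y.

Definition walk (n : nat) (x y : T) : bool :=
  [exists p : n.-tuple T, path e x p && (last x p == y)].

(* The least length of a walk from x to y. A shortest walk has fewer than
   #|T| edges, so the search range suffices; the value is #|T| when x and y
   lie in different components. *)
Definition gdist (x y : T) : nat :=
  find (fun n => walk n x y) (iota 0 #|T|).

Definition diameter : nat := \max_(x : T) \max_(y : T) gdist x y.

(* Distance i - 1 is written (gdist x z).+1 == i, so that c 0 counts the empty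
   set and no truncated subtraction occurs. The values of a, b, c at
   i > diameter are irrelevant. *)
Definition distance_regular : Prop :=
  [/\ simple_graph, connected_graph &
      exists a b c : nat -> nat,
      forall (i : nat) (x y : T), i <= diameter -> gdist x y = i ->
      [/\ #|[set z | e y z & (gdist x z).+1 == i]| = c i,
          #|[set z | e y z & gdist x z == i]| = a i
        & #|[set z | e y z & gdist x z == i.+1]| = b i]].

Definition antipodal : Prop :=
  forall u v w : T, gdist u v = diameter -> gdist u w = diameter ->
  gdist v w = diameter \/ v = w.

Definition distance_mx (F : nzRingType) : 'M[F]_#|T| :=
  (\matrix_(i, j) (gdist (enum_val i) (enum_val j))%:R)%R.

(* The distance matrix has exactly k distinct eigenvalues. The field C is
   algebraically closed, so no eigenvalue is missed. *)
Definition num_distance_eigenvalues (C : numClosedFieldType) (k : nat) : Prop :=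
  exists s : seq C,
    [/\ uniq s, size s = k &
        forall a : C, eigenvalue (distance_mx C) a = (a \in s)].

End Graphs.

Section GeneralizedQuadrangles.

Variables (P L : finType) (inc : P -> L -> bool).

Definition collinear (p q : P) : bool := [exists l, inc p l && inc q l].

(* gq_nonempty excludes the structure without points and lines, which
   satisfies the other axioms vacuously. *)
Record generalized_quadrangle (s t : nat) : Prop := GeneralizedQuadrangle {
  gq_nonempty : 0 < #|P|;
  gq_line_size : forall l : L, #|[set p | inc p l]| = s.+1;
  gq_point_degree : forall p : P, #|[set l | inc p l]| = t.+1;
  gq_common_line : forall (p q : P) (l m : L), p != q ->
    inc p l -> inc q l -> inc p m -> inc q m -> l = m;
  gq_projection : forall (p : P) (l : L), ~~ inc p l ->
    exists! q : P, inc q l /\ collinear p q }.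

Definition spread (S : {set L}) : Prop :=
  (forall l m : L, l \in S -> m \in S -> l != m ->
     forall p : P, ~~ (inc p l && inc p m)) /\
  (forall p : P, exists2 l : L, l \in S & inc p l).

Definition collinearity_graph : rel P :=
  [rel p q | (p != q) && collinear p q].

Definition remove_spread (S : {set L}) : rel P :=
  [rel p q | collinearity_graph p q &&
             ~~ [exists l in S, inc p l && inc q l]].

End GeneralizedQuadrangles.

(* Main.v *)
Require Import Defs.
From HB Require Import structures.
From mathcomp Require Import all_boot all_order all_algebra all_field.
From mathcomp Require Import zify ring.

Set Implicit Arguments.
Unset Strict Implicit.
Unset Printing Implicit Defensive.

(** Call two points cospread when they lie on the same spread line. In G,
    distinct cospread points are at distance 3, the other collinear pairs are at
    distance 1, and the non-collinear pairs are at distance 2. The projection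
    axiom gives every count needed: a point has one collinear point on each line
    missing it, so non-collinear points have t + 1 common collinear points and a
    point outside a spread line sees exactly one point of that line.
    Inclusion-exclusion then turns these counts into the intersection numbers of
    G ([card_adjacent_gdist]).

    For the spectrum, let B and M be the 0-1 matrices of collinearity and
    cospreadness (both reflexive) and J the all-ones matrix. The distance matrix
    is D = 2J - B + 2M - 3I, and the same counts say that B and M commute, that
    M^2 = (s+1)M, BM = J + sM, and that B^2 is a combination of J, B and I. For
    t = s + 2 these relations combine to
      (D - (s-1)) (D + (s+3)) = multiple of J.
    Off the all-ones vector, this leaves only the eigenvalues s - 1 = t - 3 and
    -(s+3) = -(t+1); both occur because D has two rows that differ off the
    diagonal. The third eigenvalue is the common row sum of D. For general t the
    vectors constant on spread lines and those summing to zero on each spread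
    line yield the three values s - 1, -s - 3 and t - 3; the relation t = s + 2
    is what makes the first and the last coincide.

    The infinite family is the quadrangle attached to a hyperoval. For F of order
    q = 2^h, take the points of AG(3,q) and the affine lines whose direction
    belongs to the hyperoval {(1,a,a^2)} u {(0,1,0), (0,0,1)}. No three of these
    directions are coplanar, which excludes triangles, and every plane through
    one of them contains exactly one other, which provides the projections. This
    is a GQ(q-1,q+1), and each parallel class of lines is a spread. *)

(** * Distances and walks *)

Lemma card_setE (T : finType) (p : pred T) : #|[set z | p z]| = \sum_z p z.
Proof. by rewrite cardsE -sum1_card big_mkcond. Qed.

Section Distance.
Variables (T : finType) (e : rel T).

Lemma walk0 x y : walk e 0 x y = (x == y).
Proof.
apply/existsP/eqP => [[p]|->]; first by rewrite tuple0 /= => /eqP.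
by exists [tuple]; rewrite /= eqxx.
Qed.

Lemma walkS n x y : walk e n.+1 x y = [exists z, e x z && walk e n z y].
Proof.
apply/existsP/existsP => [[p]|[z /andP[exz /existsP[p /andP[zp lp]]]]].
  case/tupleP: p => z p /= /andP[/andP[exz zp] lp].
  by exists z; rewrite exz; apply/existsP; exists p; rewrite zp.
by exists [tuple of z :: p]; rewrite /= exz zp.
Qed.

Lemma walk1 x y : walk e 1 x y = e x y.
Proof.
rewrite walkS; apply/existsP/idP => [[z]|exy].
  by rewrite walk0 => /andP[exz /eqP <-].
by exists y; rewrite walk0 exy eqxx.
Qed.

Lemma gdist_eq n x y : n < #|T| -> walk e n x y ->
  (forall m, m < n -> ~~ walk e m x y) -> gdist e x y = n.
Proof.
move=> ltn wn minn; rewrite /gdist.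
have -> : iota 0 #|T| = iota 0 n ++ n :: iota n.+1 (#|T| - n.+1).
  by rewrite -{1}(subnKC ltn) addSnnS iotaD.
rewrite find_cat size_iota /= wn addn0.
case: hasP => // -[m]; rewrite mem_iota add0n => /andP[_ /minn] nw w.
by rewrite w in nw.
Qed.

Lemma gdist_connected x y : gdist e x y < #|T| -> connect e x y.
Proof.
move=> lt; have : has (fun n => walk e n x y) (iota 0 #|T|).
  by rewrite has_find size_iota.
case/hasP=> n _ /existsP[p].
by case/andP=> xp /eqP <-; apply/connectP; exists p.
Qed.

End Distance.

(** * Counting in a quadrangle with a spread *)

Section SpreadRemoval.

Variables (P L : finType) (inc : P -> L -> bool) (S : {set L}) (s t : nat).
Hypothesis gq : generalized_quadrangle inc s t.
Hypothesis spS : spread inc S.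

Let cospread x y := [exists l in S, inc x l && inc y l].
Let col := collinear inc.

Lemma collinear_sym x y : col x y = col y x.
Proof. by apply: eq_existsb => l; rewrite andbC. Qed.

Lemma collinear_refl x : col x x.
Proof.
have [_ /(_ x) [l _ xl]] := spS.
by apply/existsP; exists l; rewrite xl.
Qed.

Lemma cospreadE x y l : l \in S -> inc x l -> cospread x y = inc y l.
Proof.
move=> lS xl; apply/exists_inP/idP => [[m mS /andP[xm ym]]|yl]; last first.
  by exists l; rewrite ?xl.
have [-> //|ml] := eqVneq l m.
by have [/(_ l m lS mS ml x)] := spS; rewrite xl xm.
Qed.

Lemma cospread_refl x : cospread x x.
Proof. by have [_ /(_ x) [l lS xl]] := spS; rewrite (cospreadE _ lS xl). Qed.

Lemma cospread_sym x y : cospread x y = cospread y x.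
Proof. by apply: eq_existsb => l; rewrite (andbC (inc x l)). Qed.

Lemma cospread_transl x y z : cospread x y -> cospread x z = cospread y z.
Proof.
have [_ /(_ x) [l lS xl]] := spS.
by rewrite !(cospreadE _ lS xl) => yl; rewrite (cospreadE _ lS yl).
Qed.

Lemma cospread_collinear x y : cospread x y -> col x y.
Proof. by case/exists_inP => l _ xyl; apply/existsP; exists l. Qed.

Lemma collinear_on x y l : inc x l -> inc y l -> col x y.
Proof. by move=> xl yl; apply/existsP; exists l; rewrite xl. Qed.

(** Off the line l, the point z would have the two projections x and y. *)
Lemma no_triangle x y z l : x != y -> inc x l -> inc y l ->
  col x z -> col y z -> inc z l.
Proof.
move=> xy xl yl; rewrite (collinear_sym x) (collinear_sym y) => zx zy.
apply: contraNT xy => zl; have [q [_ uq]] := gq_projection gq zl.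
by rewrite -(uq x) // -(uq y).
Qed.

Lemma card_projection x l : ~~ inc x l -> #|[set z | inc z l & col x z]| = 1.
Proof.
move=> xl; have [q [[ql xq] uq]] := gq_projection gq xl.
apply/eqP/cards1P; exists q; apply/setP => z; rewrite !inE.
by apply/andP/eqP => [[zl xz]|->]; [rewrite (uq z)|].
Qed.

(** Each point of A is on exactly one line through x, so the lines through x
    partition A. *)
Lemma card_by_lines x (A : {set P}) :
  (forall z, z \in A -> x != z /\ col x z) ->
  #|A| = \sum_(l | inc x l) #|[set z in A | inc z l]|.
Proof.
move=> Ax; rewrite -sum1_card.
under [RHS]eq_bigr => l _ do rewrite -sum1_card.
rewrite (exchange_big_dep [in A]) /=; last first.
  by move=> l z _; rewrite inE => /andP[].
apply: eq_bigr => z zA; have [xz /existsP[l /andP[xl zl]]] := Ax z zA.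
rewrite (big_pred1 l) // => m; rewrite !inE zA /=.
apply/andP/eqP => [[xm zm]|-> //].
exact: (gq_common_line gq xz).
Qed.

Lemma card_line l : #|[set z | inc z l]| = s.+1.
Proof. exact: gq_line_size gq l. Qed.

Lemma card_collinear x : #|[set z | col x z]| = (s * t + s).+1.
Proof.
rewrite (cardsD1 x) inE collinear_refl add1n; congr _.+1.
rewrite (@card_by_lines x) => [|z]; last first.
  by rewrite !inE eq_sym => /andP[].
rewrite (eq_bigr (fun=> s)) => [|l xl].
  by rewrite sum_nat_const -mulnSr mulnC -(gq_point_degree gq x) cardsE.
apply/eqP; rewrite -eqSS -(card_line l) (cardsD1 x [set z | inc z l]) inE xl add1n eqSS.
apply/eqP/eq_card => z; rewrite !inE -andbA; congr (_ && _).
by apply/andP/idP => [[]//|zl]; rewrite (collinear_on xl zl).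
Qed.

Lemma card_cospread x : #|[set z | cospread x z]| = s.+1.
Proof.
have [_ /(_ x) [l lS xl]] := spS; rewrite -(card_line l).
by apply: eq_card => z; rewrite !inE (cospreadE _ lS xl).
Qed.

Lemma card_cospread2 x y :
  #|[set z | cospread x z & cospread z y]| = cospread x y * s.+1.
Proof.
have [xy|xy] := boolP (cospread x y); last first.
  apply/eqP; rewrite cards_eq0; apply/eqP/setP => z; rewrite !inE.
  by apply: contraNF xy => /andP[xz zy]; rewrite (cospread_transl _ xz).
rewrite mul1n -(card_cospread x); apply: eq_card => z; rewrite !inE.
by rewrite (cospread_sym z) -(cospread_transl _ xy) andbb.
Qed.

(** The points z run over the spread line of y, which either contains x or
    carries only the projection of x. *)
Lemma card_collinear_cospread x y :
  #|[set z | col x z & cospread z y]| = if cospread x y then s.+1 else 1.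
Proof.
have [_ /(_ y) [l lS yl]] := spS.
rewrite cospread_sym (cospreadE _ lS yl).
have -> : [set z | col x z & cospread z y] = [set z | inc z l & col x z].
  by apply/setP => z; rewrite !inE cospread_sym (cospreadE _ lS yl) andbC.
case: ifPn => [xl|/card_projection //].
rewrite -(card_line l); apply: eq_card => z; rewrite !inE.
by apply/andP/idP => [[]//|zl]; rewrite (collinear_on xl zl).
Qed.

(** If x and y are collinear, the common points are those of their line; if not,
    each of the t + 1 lines through x carries the projection of y and nothing
    else. *)
Lemma card_collinear2 x y :
  #|[set z | col x z & col z y]| =
  if x == y then (s * t + s).+1 else if col x y then s.+1 else t.+1.
Proof.
case: eqVneq => [->|xy].
  rewrite -(card_collinear y); apply: eq_card => z; rewrite !inE.
  by rewrite collinear_sym andbb.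
case: ifPn => [/existsP[l /andP[xl yl]]|nxy].
  rewrite -(card_line l); apply: eq_card => z; rewrite !inE collinear_sym.
  apply/andP/idP => [[zx zy]|zl]; last by rewrite !(collinear_on zl).
  by apply: (no_triangle xy xl yl); rewrite collinear_sym.
rewrite (@card_by_lines x) => [|z]; last first.
  by rewrite inE => /andP[xz zy]; split=> //; apply: contraNneq nxy => ->.
rewrite (eq_bigr (fun=> 1)) => [|l xl].
  by rewrite sum1_card -(gq_point_degree gq x) cardsE.
have yl : ~~ inc y l by apply: contra nxy; apply: collinear_on.
rewrite -(card_projection yl); apply: eq_card => z; rewrite !inE.
rewrite (collinear_sym z y); apply/andP/andP => [[/andP[_ yz] zl]|[zl yz]] //.
by rewrite yz (collinear_on xl zl).
Qed.

(** * Distances after the removal of the spread *)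

Let G := remove_spread inc S.

Lemma remove_spreadE x y : G x y = col x y && ~~ cospread x y.
Proof.
rewrite /G /remove_spread /collinearity_graph /=.
rewrite -/(cospread x y) -/(col x y).
by have [->|] := eqVneq x y; rewrite ?cospread_refl ?andbF.
Qed.

Lemma remove_spread_sym x y : G x y = G y x.
Proof. by rewrite !remove_spreadE collinear_sym cospread_sym. Qed.

Hypotheses (s_gt0 : 0 < s) (t_gt1 : 1 < t).

(** Adjacency is collinearity minus cospreadness, so inclusion-exclusion over the
    two sides reduces this count to the previous ones. *)
Lemma card_adjacent2 x y :
  #|[set z | G x z & G z y]| =
  if x == y then s * t else if cospread x y then 0
  else if col x y then s.-1 else t.-1.
Proof.
have : #|[set z | G x z & G z y]| + #|[set z | col x z & cospread z y]|
     + #|[set z | col y z & cospread z x]|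
     = #|[set z | col x z & col z y]|
     + #|[set z | cospread x z & cospread z y]|.
  rewrite !card_setE -!big_split; apply: eq_bigr => z _ /=.
  rewrite !remove_spreadE (cospread_sym z x) (collinear_sym y z).
  have := @cospread_collinear x z; have := @cospread_collinear z y.
  by case: (cospread x z); case: (cospread z y); case: (col x z);
    case: (col z y) => // i j; (have := i isT) || (have := j isT).
rewrite !card_collinear_cospread card_cospread2 card_collinear2.
rewrite (cospread_sym y x); have := @cospread_collinear x y.
case: eqVneq => [->|_]; first by rewrite cospread_refl; lia.
case: (cospread x y) => [/(_ isT) ->|_]; first by lia.
by case: (col x y); lia.
Qed.

Lemma exists_adjacent x : exists y, G x y.
Proof.
have : 0 < #|[set z | G x z & G z x]|.
  by rewrite card_adjacent2 eqxx muln_gt0 s_gt0 ltnW.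
by case/card_gt0P => y; rewrite inE => /andP[]; exists y.
Qed.

(** On the spread line of x, the neighbour z sees x and nothing else; this makes
    a path of length 3 from x to y through z. *)
Lemma adjacent_noncollinear x y z :
  G x z -> cospread x y -> x != y -> ~~ col z y.
Proof.
rewrite remove_spreadE => /andP[xz nxz] cxy xy; apply: contra nxz => zy.
have [_ /(_ x) [l lS xl]] := spS.
move: cxy; rewrite !(cospreadE _ lS xl) => yl.
by apply: (no_triangle xy xl yl); rewrite // collinear_sym.
Qed.

Lemma walk2 x y : walk G 2 x y = (0 < #|[set z | G x z & G z y]|).
Proof.
rewrite walkS; apply/existsP/card_gt0P => -[z].
  by rewrite walk1; exists z; rewrite inE.
by rewrite inE; exists z; rewrite walk1.
Qed.

Lemma card_points_gt3 : 3 < #|P|.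
Proof.
have /card_gt0P[x _] := gq_nonempty gq.
apply: leq_trans (max_card (mem [set z | col x z])).
by rewrite card_collinear; move: s_gt0 t_gt1; nia.
Qed.

Lemma gdist_remove_spread x y :
  gdist G x y = if x == y then 0 else if cospread x y then 3
                else if col x y then 1 else 2.
Proof.
have P_gt3 := card_points_gt3.
have nc z : ~~ col z y -> walk G 2 z y.
  move=> nzy; rewrite walk2 card_adjacent2.
  case: eqVneq => [zy|_]; first by rewrite zy collinear_refl in nzy.
  case: ifPn => [/cospread_collinear|_]; first by rewrite (negPf nzy).
  by rewrite (negPf nzy); move: t_gt1; lia.
case: ifPn => [/eqP ->|xy].
  by apply: gdist_eq; rewrite ?walk0 //; apply: leq_trans P_gt3.
case: ifPn => [cxy|ncxy].
  apply: gdist_eq => //.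
    have [z xz] := exists_adjacent x.
    rewrite walkS; apply/existsP; exists z; rewrite xz nc //.
    exact: adjacent_noncollinear xz cxy xy.
  case=> [|[|[|//]]] _; rewrite ?walk0 ?walk1 ?walk2 //.
    by rewrite remove_spreadE cxy andbF.
  by rewrite card_adjacent2 (negPf xy) cxy.
case: ifPn => [xcy|nxcy].
  apply: gdist_eq; first exact: leq_trans P_gt3.
    by rewrite walk1 remove_spreadE xcy.
  by case=> // _; rewrite walk0.
apply: gdist_eq; [exact: leq_trans P_gt3|exact: nc|].
case=> [|[|//]] _; rewrite ?walk0 ?walk1 //.
by rewrite remove_spreadE (negPf nxcy).
Qed.

Lemma exists_cospread x : exists2 y, x != y & cospread x y.
Proof.
have : 1 < #|[set z | cospread x z]| by rewrite card_cospread ltnS.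
rewrite (cardsD1 x) inE cospread_refl ltnS => /card_gt0P[y].
by rewrite !inE eq_sym => /andP[]; exists y.
Qed.

Lemma diameter_remove_spread : diameter G = 3.
Proof.
apply/eqP; rewrite eqn_leq; apply/andP; split.
  apply/bigmax_leqP => x _; apply/bigmax_leqP => y _.
  by rewrite gdist_remove_spread; case: (x == y); case: (cospread x y); case: (col x y).
have /card_gt0P[x _] := gq_nonempty gq.
have [y xy cxy] := exists_cospread x.
have -> : 3 = gdist G x y by rewrite gdist_remove_spread (negPf xy) cxy.
by rewrite (bigmax_sup x) // (bigmax_sup y).
Qed.

Lemma gdist3 x y : (gdist G x y == 3) = (x != y) && cospread x y.
Proof.
rewrite gdist_remove_spread.
by case: (x == y); case: (cospread x y); case: (col x y).
Qed.

Lemma gdist1 x y : (gdist G x y == 1) = G x y.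
Proof.
rewrite gdist_remove_spread remove_spreadE.
have [->|_] := eqVneq x y; first by rewrite cospread_refl andbF.
by case: (cospread x y); case: (col x y).
Qed.

Lemma gdist0 x y : (gdist G x y == 0) = (x == y).
Proof.
rewrite gdist_remove_spread.
by case: (x == y); case: (cospread x y); case: (col x y).
Qed.

Lemma antipodal_remove_spread : antipodal G.
Proof.
move=> u v w; rewrite diameter_remove_spread.
move=> /eqP; rewrite gdist3 => /andP[_ uv] /eqP; rewrite gdist3 => /andP[_ uw].
have [->|vw] := eqVneq v w; [by right|left; apply/eqP].
by rewrite gdist3 vw -(cospread_transl _ uv).
Qed.

Lemma card_adjacent x : #|[set z | G x z]| = s * t.
Proof.
have := card_adjacent2 x x; rewrite eqxx => <-; apply: eq_card => z.
by rewrite !inE (remove_spread_sym z) andbb.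
Qed.

(** For vertices x and y at distance i, the number of neighbours of y at distance
    j from x. The case j = 2 is what the other distances leave of the degree
    s * t. *)
Definition intersection_number j i :=
  match j with
  | 0 => (i == 1 : nat)
  | 1 => nth 0 [:: s * t; s.-1; t.-1] i
  | 2 => s * t - ((i == 1) + nth 0 [:: s * t; s.-1; t.-1] i + (i == 2))
  | 3 => (i == 2 : nat)
  | _ => 0
  end.

(** Distance 1 is [card_adjacent2]. For distance 3, the neighbours of y on the
    spread line of x are the points of that line collinear with y but not cospread
    with it, and x itself must be left out. *)
Lemma card_adjacent_gdist x y j :
  #|[set z | G y z & gdist G x z == j]| = intersection_number j (gdist G x y).
Proof.
set m := fun j => #|[set z | G y z & gdist G x z == j]|.
have m0 : m 0 = intersection_number 0 (gdist G x y).
  rewrite /= gdist1 remove_spread_sym /m card_setE (bigD1 x) //=.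
  rewrite gdist0 eqxx andbT.
  by rewrite big1 ?addn0 // => z; rewrite gdist0 eq_sym andbC => /negPf ->.
have m1 : m 1 = intersection_number 1 (gdist G x y).
  transitivity #|[set z | G x z & G z y]|.
    by apply: eq_card => z; rewrite !inE gdist1 (remove_spread_sym z) andbC.
  rewrite card_adjacent2 gdist_remove_spread /=.
  by case: (x == y); case: (cospread x y); case: (col x y).
have m3 : m 3 = intersection_number 3 (gdist G x y).
  have eq1 : #|[set z | G y z & cospread z x]| = m 3 + G x y.
    rewrite /m !card_setE (bigD1 x) //= [in RHS](bigD1 x) //= gdist3 eqxx andbF.
    rewrite cospread_refl andbT add0n addnC remove_spread_sym; congr (_ + _).
    by apply: eq_bigr => z zx; rewrite gdist3 eq_sym zx cospread_sym.
  have eq2 : #|[set z | G y z & cospread z x]|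
           + #|[set z | cospread y z & cospread z x]|
           = #|[set z | col y z & cospread z x]|.
    rewrite !card_setE -big_split; apply: eq_bigr => z _ /=.
    rewrite remove_spreadE; have := @cospread_collinear y z.
    by case: (col y z); case: (cospread y z); case: (cospread z x) => //
      /(_ isT).
  move: eq2; rewrite eq1 card_cospread2 card_collinear_cospread.
  rewrite (cospread_sym y) gdist_remove_spread remove_spreadE.
  case: eqVneq => [->|_]; first by rewrite cospread_refl andbF /=; lia.
  by case: (cospread x y); case: (col x y) => /=; lia.
have m2 : m 2 = intersection_number 2 (gdist G x y).
  have : #|[set z | G y z]| = m 0 + m 1 + m 2 + m 3.
    rewrite /m !card_setE -!big_split; apply: eq_bigr => z _ /=.
    rewrite gdist_remove_spread.
    by case: (x == z); case: (cospread x z); case: (col x z); case: (G y z).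
  rewrite card_adjacent m0 m1 m3 /=; lia.
case: j => [|[|[|[|j]]]] //=; apply/eqP; rewrite cards_eq0; apply/eqP/setP => z.
rewrite !inE gdist_remove_spread.
by case: (x == z); case: (cospread x z); case: (col x z); rewrite andbF.
Qed.

Lemma distance_regular_remove_spread : distance_regular G.
Proof.
split.
- split; first exact: remove_spread_sym.
  by move=> x; rewrite remove_spreadE cospread_refl andbF.
- move=> x y; apply: gdist_connected; apply: leq_trans card_points_gt3.
  by rewrite gdist_remove_spread; do !case: ifP.
exists (fun i => intersection_number i i), (fun i => intersection_number i.+1 i).
exists (fun i => if i is j.+1 then intersection_number j i else 0).
move=> i x y _ <-; split; rewrite ?card_adjacent_gdist //.
case dxy: (gdist G x y) => [|k].
  (* At distance 0 the condition (gdist x z).+1 == 0 is never met. *)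
  by apply/eqP; rewrite cards_eq0; apply/eqP/setP => z; rewrite !inE andbF.
rewrite -dxy -card_adjacent_gdist; apply: eq_card => z.
by rewrite !inE dxy eqSS.
Qed.

End SpreadRemoval.

(** * Matrices with constant row sums and a quadratic relation modulo J *)

Section ThreeEigenvalues.

Import GRing.Theory.
Local Open Scope ring_scope.

Variables (F : fieldType) (n : nat) (D : 'M[F]_n) (r a b c : F).

Let ones_row : 'rV[F]_n := const_mx 1.
Let ones_col : 'cV[F]_n := const_mx 1.

Hypothesis row_sum : ones_row *m D = r *: ones_row.
Hypothesis col_sum : D *m ones_col = r *: ones_col.
Hypothesis quadratic :
  (D - a%:M) *m (D - b%:M) = c *: (ones_col *m ones_row).

Lemma quadratic_sym : (D - b%:M) *m (D - a%:M) = c *: (ones_col *m ones_row).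
Proof.
rewrite -quadratic !mulmxBl !mulmxBr !mul_scalar_mx !mul_mx_scalar.
move: (D *m D) => D2; apply/matrixP => i j; rewrite !mxE.
by case: (i == j); rewrite ?mulr1n ?mulr0n; ring.
Qed.

(** Comparing v D J computed in two ways, an eigenvector v for x <> r has
    coordinate sum 0, so the quadratic relation kills it. *)
Lemma eigenvalue_quadratic x : eigenvalue D x -> x \in [:: r; a; b].
Proof.
case/eigenvalueP => v vD v0; rewrite !inE.
have /eqP : (x - r) *: (v *m ones_col) = 0.
  by rewrite scalerBl scalemxAl -vD -mulmxA col_sum -scalemxAr subrr.
rewrite scaler_eq0 subr_eq0 => /orP[-> //|/eqP v1].
have : (x - a) *: ((x - b) *: v) = 0.
  have vE y : v *m (D - y%:M) = (x - y) *: v.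
    by rewrite mulmxBr vD mul_mx_scalar scalerBl.
  rewrite -vE scalemxAl -vE -mulmxA quadratic.
  by rewrite -scalemxAr mulmxA v1 mul0mx scaler0.
move/eqP; rewrite !scaler_eq0 (negPf v0) orbF !subr_eq0.
by case/orP => ->; rewrite ?orbT.
Qed.

(** All rows of J are equal, so the difference of two rows of D - x is an
    eigenvector for y; in a column off both diagonal entries it agrees with the
    difference of the rows of D, which keeps it from vanishing. *)
Lemma eigenvalue_row_difference x y i i' j :
  (D - x%:M) *m (D - y%:M) = c *: (ones_col *m ones_row) ->
  j != i -> j != i' -> D i j != D i' j -> eigenvalue D y.
Proof.
move=> Dxy ji ji' Dij.
apply/eigenvalueP; exists (row i (D - x%:M) - row i' (D - x%:M)).
  have : (row i (D - x%:M) - row i' (D - x%:M)) *m (D - y%:M) = 0.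
    rewrite mulmxBl -!row_mul Dxy; apply/rowP => k; rewrite !mxE.
    by rewrite !big_ord1 !mxE subrr.
  by rewrite mulmxBr mul_mx_scalar => /eqP; rewrite subr_eq0 => /eqP.
apply/eqP => /rowP /(_ j) /eqP; rewrite !mxE !(eq_sym _ j) (negPf ji) (negPf ji').
by rewrite !subr0 subr_eq0 (negPf Dij).
Qed.

Lemma eigenvalues_of_quadratic i i' j :
  j != i -> j != i' -> D i j != D i' j ->
  forall x, eigenvalue D x = (x \in [:: r; a; b]).
Proof.
move=> ji ji' Dij x; apply/idP/idP; first exact: eigenvalue_quadratic.
rewrite !inE => /or3P[] /eqP ->.
- apply/eigenvalueP; exists ones_row => //.
  by apply/eqP => /rowP /(_ i) /eqP; rewrite !mxE oner_eq0.
- exact: eigenvalue_row_difference quadratic_sym ji ji' Dij.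
exact: eigenvalue_row_difference quadratic ji ji' Dij.
Qed.

End ThreeEigenvalues.

(** * The distance spectrum for t = s + 2 *)

Section Spectrum.

Import GRing.Theory Num.Theory.
Local Open Scope ring_scope.

Variables (P L : finType) (inc : P -> L -> bool) (S : {set L}) (s : nat).
Variable C : numClosedFieldType.
Hypothesis gq : generalized_quadrangle inc s s.+2.
Hypothesis spS : spread inc S.
Hypothesis s_gt0 : (0 < s)%N.

Let cospread x y := [exists l in S, inc x l && inc y l].
Let col := collinear inc.
Let G := remove_spread inc S.

Definition relation_mx (e : rel P) : 'M[C]_#|P| :=
  \matrix_(i, j) (e (enum_val i) (enum_val j))%:R.

Lemma relation_mx_mul (e e' : rel P) i j :
  (relation_mx e *m relation_mx e') i j =
  #|[set z | e (enum_val i) z & e' z (enum_val j)]|%:R.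
Proof.
rewrite mxE card_setE natr_sum [RHS]big_enum_val; apply: eq_bigr => k _.
by rewrite !mxE -natrM mulnb.
Qed.

Let ones_row : 'rV[C]_#|P| := const_mx 1.
Let ones_col : 'cV[C]_#|P| := const_mx 1.

Lemma relation_mx_row_sum (e : rel P) k :
  (forall y, #|[set z | e z y]| = k) ->
  ones_row *m relation_mx e = k%:R *: ones_row.
Proof.
move=> ek; apply/rowP => j; rewrite !mxE mulr1 -(ek (enum_val j)).
rewrite card_setE natr_sum [RHS]big_enum_val; apply: eq_bigr => i _.
by rewrite !mxE mul1r.
Qed.

Lemma relation_mx_col_sum (e : rel P) k :
  (forall x, #|[set z | e x z]| = k) ->
  relation_mx e *m ones_col = k%:R *: ones_col.
Proof.
move=> ek; apply/colP => j; rewrite !mxE mulr1 -(ek (enum_val j)).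
rewrite card_setE natr_sum [RHS]big_enum_val; apply: eq_bigr => i _.
by rewrite !mxE mulr1.
Qed.

Let J := ones_col *m ones_row.
Let B := relation_mx col.
Let M := relation_mx cospread.
Let Y := 2 *: M - B.

Lemma onesE i j : J i j = 1.
Proof. by rewrite !mxE big_ord1 !mxE mulr1. Qed.

Lemma distance_mxE : distance_mx G C = 2 *: J + Y - 3%:M.
Proof.
apply/matrixP => i j; rewrite [RHS]mxE [X in X + _]mxE [X in X + _ + _]mxE onesE.
rewrite !mxE (gdist_remove_spread gq spS) // (inj_eq enum_val_inj).
rewrite -/(cospread _ _) -/(col _ _).
case: eqVneq => [->|_].
  have -> : cospread (enum_val j) (enum_val j) by exact: cospread_refl.
  have -> : col (enum_val j) (enum_val j) by exact: collinear_refl spS _.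
  by rewrite /=; ring.
have := @cospread_collinear _ _ inc S (enum_val i) (enum_val j).
rewrite -/(cospread _ _) -/(col _ _).
by case: (cospread _ _) => [/(_ isT) ->|_]; last case: (col _ _);
  rewrite /=; ring.
Qed.

(** The row sum of 2M - B, where B and M have row sums s(s+2) + s + 1 and
    s + 1. *)
Definition reduced_sum : C := 2 * s.+1%:R - (s * s.+2 + s).+1%:R.

Lemma reduced_row_sum : ones_row *m Y = reduced_sum *: ones_row.
Proof.
rewrite mulmxBr -scalemxAr (@relation_mx_row_sum _ s.+1).
  rewrite (@relation_mx_row_sum _ (s * s.+2 + s).+1) ?scalerA -?scalerBl //.
  move=> y; rewrite -(card_collinear gq spS y); apply: eq_card => z.
  by rewrite !inE collinear_sym.
move=> y; rewrite -(card_cospread gq spS y); apply: eq_card => z.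
by rewrite !inE /cospread cospread_sym.
Qed.

Lemma reduced_col_sum : Y *m ones_col = reduced_sum *: ones_col.
Proof.
rewrite mulmxBl -scalemxAl (@relation_mx_col_sum _ s.+1).
  rewrite (@relation_mx_col_sum _ (s * s.+2 + s).+1) ?scalerA -?scalerBl //.
  exact: card_collinear gq spS.
exact: card_cospread gq spS.
Qed.

(** In general B^2 = (t+1)J + (s-t)B + st, and the terms in M of Y^2 sum to 4M.
    Hence only t = s + 2 gives the multiple 2Y = 4M - 2B. *)
Lemma reduced_sqr : Y *m Y = 2 *: Y + (s%:R - 1) *: J + (s * s.+2)%:R%:M.
Proof.
have MM : M *m M = s.+1%:R *: M.
  apply/matrixP => i j; rewrite relation_mx_mul [RHS]mxE [M i j]mxE.
  by rewrite (card_cospread2 gq spS) natrM mulrC.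
have BM : B *m M = J + s%:R *: M.
  apply/matrixP => i j; rewrite relation_mx_mul (card_collinear_cospread gq spS).
  rewrite [RHS]mxE onesE [X in _ + X]mxE [M i j]mxE -/(cospread _ _).
  by case: (cospread _ _); rewrite /= ?mulrSr; ring.
have MB : M *m B = J + s%:R *: M.
  rewrite -BM; apply/matrixP => i j; rewrite !relation_mx_mul.
  rewrite (card_collinear_cospread gq spS).
  have -> : [set z | cospread (enum_val i) z & col z (enum_val j)] =
            [set z | col (enum_val j) z & cospread z (enum_val i)].
    apply/setP => z; rewrite !inE andbC /col (collinear_sym inc z).
    by rewrite /cospread (cospread_sym inc _ z).
  by rewrite (card_collinear_cospread gq spS) cospread_sym.
have BB : B *m B = s.+3%:R *: J - 2 *: B + (s * s.+2)%:R%:M.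
  apply/matrixP => i j; rewrite relation_mx_mul (card_collinear2 gq spS).
  rewrite [RHS]mxE [X in X + _]mxE [X in X + _ + _]mxE.
  rewrite [X in _ + X + _]mxE [X in _ - X + _]mxE.
  rewrite onesE [B i j]mxE [_%:M _ _]mxE (inj_eq enum_val_inj) -/(col _ _).
  have colT x : col x x by exact: collinear_refl spS _.
  case: eqVneq => [->|_]; rewrite ?colT ?mulr1n ?mulr0n.
    by rewrite /= mulrSr natrD natrM !mulrSr; ring.
  by case: (col _ _); rewrite /= !mulrSr; ring.
rewrite /Y mulmxBl !mulmxBr -!scalemxAl -!scalemxAr MM MB BM BB.
move: (J) (B) (M) => J0 B0 M0; apply/matrixP => i j; rewrite !mxE.
by case: (i == j); rewrite ?mulr1n ?mulr0n ?natrM !mulrSr; ring.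
Qed.

Lemma ones_inner : ones_row *m ones_col = #|P|%:R%:M.
Proof.
apply/matrixP => i j; rewrite !ord1 !mxE mulr1n.
rewrite (eq_bigr (fun=> 1)) => [|k _]; last by rewrite !mxE mulr1.
by rewrite sumr_const card_ord.
Qed.

Lemma distance_mx_quadratic :
  (distance_mx G C - (s%:R - 1)%:M) *m (distance_mx G C - (- (s%:R + 3))%:M) =
  (4 * #|P|%:R + 4 * reduced_sum + s%:R - 5) *: J.
Proof.
have JJ : J *m J = #|P|%:R *: J.
  by rewrite /J mulmxA -(mulmxA ones_col) ones_inner mul_mx_scalar scalemxAl.
have JY : J *m Y = reduced_sum *: J by rewrite -mulmxA reduced_row_sum scalemxAr.
have YJ : Y *m J = reduced_sum *: J by rewrite mulmxA reduced_col_sum scalemxAl.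
move: JJ JY YJ reduced_sqr; rewrite distance_mxE.
(* The bodies of J and Y are hidden so that distributivity stops at them. *)
move: (J) (Y) => J0 Y0 JJ JY YJ YY.
rewrite !(mulmxBl, mulmxBr, mulmxDl, mulmxDr) -!scalemxAl -!scalemxAr.
rewrite !mul_scalar_mx !mul_mx_scalar JJ JY YJ YY; apply/matrixP => i j; rewrite !mxE.
by case: (i == j); rewrite ?mulr1n ?mulr0n ?natrM !mulrSr; ring.
Qed.

Let lambda : C := 2 * #|P|%:R + reduced_sum - 3.

Lemma distance_mx_row_sum : ones_row *m distance_mx G C = lambda *: ones_row.
Proof.
rewrite distance_mxE mulmxBr mulmxDr -scalemxAr reduced_row_sum mul_mx_scalar.
rewrite mulmxA ones_inner mul_scalar_mx scalerA -scalerDl -scalerBl.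
by [].
Qed.

Lemma distance_mx_col_sum : distance_mx G C *m ones_col = lambda *: ones_col.
Proof.
rewrite distance_mxE mulmxBl mulmxDl -scalemxAl reduced_col_sum mul_scalar_mx.
by rewrite -mulmxA ones_inner mul_mx_scalar scalerA -scalerDl -scalerBl.
Qed.

(** The row sum exceeds s - 1 since a point and the points collinear with it
    already number s(s+2) + s + 1. *)
Lemma uniq_eigenvalues : uniq [:: lambda; s%:R - 1; - (s%:R + 3)].
Proof.
have /card_gt0P[x _] := gq_nonempty gq.
have := max_card (mem [set z | col x z]).
rewrite (card_collinear gq spS) => n_gt.
rewrite /= !inE negb_or andbT -andbA; apply/and3P; split; apply/eqP => h.
- have : (2 * #|P| + 2 * s + 2 = s * s + 4 * s + 3)%N.
    apply/eqP; rewrite -(eqr_nat C) !natrD !natrM -subr_eq0.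
    move/eqP: h; rewrite -subr_eq0 /lambda /reduced_sum => /eqP h.
    apply/eqP; rewrite -[RHS]h !mulrSr natrD natrM !mulrSr; ring.
  move: n_gt s_gt0; nia.
- have : (2 * #|P| + 3 * s + 5 = s * s + 3 * s + 4)%N.
    apply/eqP; rewrite -(eqr_nat C) !natrD !natrM -subr_eq0.
    move/eqP: h; rewrite -subr_eq0 /lambda /reduced_sum => /eqP h.
    apply/eqP; rewrite -[RHS]h !mulrSr natrD natrM !mulrSr; ring.
  move: n_gt s_gt0; nia.
have : (2 * s + 2 = 0)%N.
  apply/eqP; rewrite -(eqr_nat C) !natrD ?natrM.
  by move/eqP: h; rewrite -subr_eq0 => /eqP h; apply/eqP; rewrite -[RHS]h; ring.
by rewrite addn2.
Qed.

Lemma num_distance_eigenvalues_remove_spread : num_distance_eigenvalues G C 3.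
Proof.
exists [:: lambda; s%:R - 1; - (s%:R + 3)].
split=> //; first exact: uniq_eigenvalues.
have t_gt1 : (1 < s.+2)%N by [].
have /card_gt0P[x _] := gq_nonempty gq.
(* In column y, the row of x has entry 1 and the row of z has entry 3. *)
have [y xy] := exists_adjacent gq spS s_gt0 t_gt1 x.
have [z yz cyz] := exists_cospread gq spS s_gt0 y.
have neq (u v : P) : u != v -> enum_rank u != enum_rank v.
  by rewrite (inj_eq enum_rank_inj).
have xNy : x != y.
  apply: contraTneq xy => ->.
  by rewrite (remove_spreadE spS) (cospread_refl spS) andbF.
apply: (eigenvalues_of_quadratic distance_mx_row_sum distance_mx_col_sum
          distance_mx_quadratic (neq y x _) (neq y z yz)); first by rewrite eq_sym.
rewrite !mxE !enum_rankK eqr_nat.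
have /eqP -> : gdist G x y == 1%N by rewrite (gdist1 gq spS).
have /eqP -> // : gdist G z y == 3%N.
by rewrite (gdist3 gq spS) // eq_sym yz cospread_sym.
Qed.

End Spectrum.

(** * The quadrangle of a hyperoval in characteristic 2 *)

Section Hyperoval.

Import GRing.Theory.
Local Open Scope ring_scope.

Variable F : finFieldType.

Definition point : finType := (F * F * F)%type.
(** The hyperoval: [Some (Some a)] is (1,a,a^2), a point of a conic,
    [Some None] is its nucleus (0,1,0), and [None] is (0,0,1). *)
Definition direction : finType := option (option F).
(** A direction d together with the common value on the line of a linear map
    with kernel spanned by d. *)
Definition line : finType := (direction * (F * F))%type.

(** A linear map onto the plane whose kernel is spanned by d; the lines in
    direction d are its fibres. *)
Definition proj (d : direction) (p : point) : F * F :=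
  let: (x, y, z) := p in
  match d with
  | None => (x, y)
  | Some None => (x, z)
  | Some (Some a) => (y - a * x, z - a ^+ 2 * x)
  end.

Definition incident (p : point) (l : line) : bool := proj l.1 p == l.2.

Definition point_on (l : line) (k : F) : point :=
  match l with
  | (None, (u, v)) => (u, v, k)
  | (Some None, (u, v)) => (u, k, v)
  | (Some (Some a), (u, v)) => (k, u + a * k, v + a ^+ 2 * k)
  end.

Lemma incidentP p l : reflect (exists k, p = point_on l k) (incident p l).
Proof.
apply: (iffP eqP) => [|[k ->]].
  case: p l => [[x y] z] [[[a|]|] [u v]] /= [<- <-].
  - by exists x; rewrite /= !subrK.
  - by exists y.
  - by exists z.
by case: l => [[[a|]|] [u v]] //=; rewrite !addrK.
Qed.

Lemma point_on_inj l : injective (point_on l).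
Proof. by case: l => [[[a|]|] [u v]] k k' []. Qed.

Lemma card_point_on l : #|[set p | incident p l]| = #|F|.
Proof.
rewrite -(card_codom (@point_on_inj l)); apply: eq_card => p; rewrite !inE.
by apply/incidentP/codomP.
Qed.

Lemma card_lines_through p : #|[set l | incident p l]| = #|F|.+2.
Proof.
rewrite -[RHS](_ : #|direction| = _); last by rewrite !card_option.
rewrite -(@card_codom _ _ (fun d : direction => (d, proj d p) : line)).
  apply: eq_card => -[d c]; rewrite !inE; apply/eqP/codomP => [/= <-|[e]].
    by exists d.
  by case=> -> ->.
by move=> d e [].
Qed.

(** Distinct points determine the direction joining them: the kernels of proj for
    distinct directions meet in 0. *)
Lemma proj_inj p q d e : p != q -> proj d p = proj d q -> proj e p = proj e q ->
  d = e.
Proof.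
have step (a b x y x' y' : F) : a != b ->
    y - a * x = y' - a * x' -> y - b * x = y' - b * x' -> x = x'.
  move=> ab h1 h2; apply: (mulfI (x := a - b)); first by rewrite subr_eq0.
  have -> : (a - b) * x = (y - b * x) - (y - a * x) by ring.
  by rewrite h1 h2; ring.
move=> pq dpq epq; apply/eqP; move: pq; apply: contraNT => de.
case: p q d e de dpq epq => [[x y] z] [[x' y'] z'] [[a|]|] [[b|]|] //= ab.
- case=> h1 h2 [h3 h4]; have xx : x = x' by apply: (step a b _ y _ y').
  by subst x'; rewrite (addIr _ h1) (addIr _ h2).
- by case=> h1 h2 [h3 h4]; subst x' z'; rewrite (addIr _ h1).
- by case=> h1 h2 [h3 h4]; subst x' y'; rewrite (addIr _ h2).
- by case=> h1 h2 [h3 h4]; subst x' z'; rewrite (addIr _ h3).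
- by case=> h1 h2 [h3 h4]; subst x' y' z'.
- by case=> h1 h2 [h3 h4]; subst x' y'; rewrite (addIr _ h4).
- by case=> h1 h2 [h3 h4]; subst x' y' z'.
Qed.

Hypothesis char2 : 2 \in [pchar F].

Lemma sqrD_char2 (x y : F) : (x + y) ^+ 2 = x ^+ 2 + y ^+ 2.
Proof. exact: (rmorphD (pFrobenius_aut char2)). Qed.

Lemma sqr_inj : injective (fun x : F => x ^+ 2).
Proof. exact: (fmorph_inj (pFrobenius_aut char2)). Qed.

Lemma collinearP p q :
  reflect (exists d, proj d p = proj d q) (collinear incident p q).
Proof.
apply: (iffP existsP) => [[[d c] /andP[/eqP dp /eqP dq]]|[d dpq]].
  by exists d; rewrite [LHS]dp [RHS]dq.
by exists (d, proj d p); rewrite /incident /= dpq eqxx.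
Qed.

(** For l with direction d, the plane spanned by p and l contains exactly one
    hyperoval direction e other than d, and q is where the line through p in
    direction e meets l. The proof finds e from the coordinates of the plane:
    for d in the conic it is the nucleus, (0,0,1) or a second point of the conic;
    for d the nucleus, finding e takes a square root, unique in characteristic
    2. *)
Lemma unique_projection p l : ~~ incident p l ->
  exists! q, incident q l /\ collinear incident p q.
Proof.
move=> pl.
suff [k [kp uk]] : exists k, collinear incident p (point_on l k) /\
   forall k', collinear incident p (point_on l k') -> k = k'.
  exists (point_on l k); split=> [|q [/incidentP[k' ->] /uk <- //]].
  by split=> //; apply/incidentP; exists k.
have colT d k : proj d p = proj d (point_on l k) ->
    collinear incident p (point_on l k) by move=> dk; apply/collinearP; exists d.
case: p l pl colT => [[x y] z] [[[a|]|] [u v]];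
  rewrite /incident /= xpair_eqE => pl colT.
- pose y' := y - a * x - u; pose z' := z - a ^+ 2 * x - v.
  (* (0, y', z') spans with d = (1, a, a^2) the plane of p and l. *)
  have yz : (y' != 0) || (z' != 0) by rewrite -negb_and !subr_eq0.
  have yE : y = y' + a * x + u by rewrite /y'; ring.
  have zE : z = z' + a ^+ 2 * x + v by rewrite /z'; ring.
  have [y0|y0] := eqVneq y' 0.
    exists x; split.
      by apply: (colT None) => /=; rewrite yE y0 add0r addrC.
    move=> k' /collinearP[[[b|]|]] /=; [|by case|by case].
    rewrite yE zE y0 => -[h1 h2].
    have : (b - a) * (x - k') = 0.
      transitivity ((u + a * k' - b * k') - (0 + a * x + u - b * x)); first by ring.
      by rewrite h1 subrr.
    move/eqP; rewrite mulf_eq0 !subr_eq0 => /orP[/eqP ba|/eqP //].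
    move: yz; rewrite y0 eqxx /= => /eqP []; subst b.
    transitivity ((z' + a ^+ 2 * x + v - a ^+ 2 * x) - v); first by ring.
    by rewrite h2; ring.
  have [z0|z0] := eqVneq z' 0.
    exists x; split.
      by apply: (colT (Some None)) => /=; rewrite zE z0 add0r addrC.
    move=> k' /collinearP[[[b|]|]] /=; [|by case|by case].
    rewrite yE zE z0 => -[h1 h2].
    have : (b ^+ 2 - a ^+ 2) * (x - k') = 0.
      transitivity ((v + a ^+ 2 * k' - b ^+ 2 * k') -
                    (0 + a ^+ 2 * x + v - b ^+ 2 * x)); first by ring.
      by rewrite h2 subrr.
    move/eqP; rewrite mulf_eq0 !subr_eq0 => /orP[/eqP/sqr_inj ba|/eqP //].
    move: y0 => /eqP []; subst b.
    transitivity ((y' + a * x + u - a * x) - u); first by ring.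
    by rewrite h1; ring.
  (* The second direction is (1, b, b^2) with b - a = z' / y', because
     b^2 - a^2 = (b - a)^2. *)
  exists (x - y' ^+ 2 / z'); split.
    apply: (colT (Some (Some (a + z' / y')))) => /=.
    rewrite sqrD_char2 yE zE; congr (_, _); field; rewrite ?y0 ?z0 //.
  move=> k' /collinearP[[[b|]|]] /=.
  + rewrite yE zE => -[h1 h2].
    have e1 : y' = (b - a) * (x - k').
      transitivity ((y' + a * x + u - b * x) + b * x - a * x - u); first by ring.
      by rewrite h1; ring.
    have e2 : z' = (b - a) ^+ 2 * (x - k').
      have -> : (b - a) ^+ 2 = b ^+ 2 - a ^+ 2.
        exact: (rmorphB (pFrobenius_aut char2)).
      transitivity ((z' + a ^+ 2 * x + v - b ^+ 2 * x)
                    + b ^+ 2 * x - a ^+ 2 * x - v); first by ring.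
      by rewrite h2; ring.
    move: z0 y0; rewrite e1 e2 !mulf_eq0 orbb !negb_or => /andP[ba xk] _.
    by field; rewrite ba xk.
  + by case=> xk h; move: z0; rewrite /z' xk h; move/eqP; case; ring.
  + by case=> xk h; move: y0; rewrite /y' xk h; move/eqP; case; ring.
- have [xu|xu] := eqVneq x u.
    exists y; split; first by apply: (colT None); rewrite /= xu.
    move=> k' /collinearP[[[b|]|]] /= [] //.
    + rewrite xu => _ /addIr zv; move: pl; by rewrite xu zv !eqxx.
    by move=> _ zv; move: pl; rewrite xu zv !eqxx.
  have xu0 : x - u != 0 by rewrite subr_eq0.
  have [g _ gK] := injF_bij sqr_inj.
  pose b := g ((z - v) / (x - u)).
  have bE : b ^+ 2 = (z - v) / (x - u) := gK _.
  exists (y - b * (x - u)); split.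
    apply: (colT (Some (Some b))); rewrite /= bE; congr (_, _); first by ring.
    by field.
  move=> k' /collinearP[[[b'|]|]] /= [].
  + move=> h1 h2.
    have -> : b = b'.
      apply: sqr_inj; rewrite /= bE; apply: (mulIf xu0); rewrite divfK //.
      transitivity ((z - b' ^+ 2 * x) - v + b' ^+ 2 * x); first by ring.
      by rewrite h2; ring.
    transitivity ((y - b' * x) + b' * u); first by ring.
    by rewrite h1; ring.
  + by move=> xu'; rewrite xu' eqxx in xu.
  + by move=> xu'; rewrite xu' eqxx in xu.
have [xu|xu] := eqVneq x u.
  exists z; split; first by apply: (colT (Some None)); rewrite /= xu.
  move=> k' /collinearP[[[b|]|]] /= [] //.
  + rewrite xu => /addIr yv; move: pl; by rewrite xu yv !eqxx.
  by move=> _ yv; move: pl; rewrite xu yv !eqxx.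
have xu0 : x - u != 0 by rewrite subr_eq0.
pose b := (y - v) / (x - u).
exists (z - b ^+ 2 * (x - u)); split.
  apply: (colT (Some (Some b))); rewrite /=; congr (_, _); last by ring.
  by rewrite /b; field.
move=> k' /collinearP[[[b'|]|]] /= [].
+ move=> h1 h2.
  have -> : b = b'.
    apply: (mulIf xu0); rewrite /b divfK //.
    transitivity ((y - b' * x) - v + b' * x); first by ring.
    by rewrite h1; ring.
  transitivity ((z - b' ^+ 2 * x) + b' ^+ 2 * u); first by ring.
  by rewrite h2; ring.
+ by move=> xu'; rewrite xu' eqxx in xu.
by move=> xu'; rewrite xu' eqxx in xu.
Qed.

Lemma generalized_quadrangle_hyperoval s :
  s.+1 = #|F| -> generalized_quadrangle incident s s.+2.
Proof.
move=> sF; split.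
- by apply/card_gt0P; exists (0, 0, 0).
- by move=> l; rewrite card_point_on sF.
- by move=> p; rewrite card_lines_through sF.
- move=> p q [d c] [e c'] pq /eqP /= pd /eqP /= qd /eqP /= pe /eqP /= qe.
  have de : d = e by apply: (proj_inj pq); rewrite ?pd ?pe.
  by rewrite -pd -pe de.
exact: unique_projection.
Qed.

Definition parallel_class : {set line} := [set l | l.1 == None].

Lemma spread_parallel_class : spread incident parallel_class.
Proof.
split=> [l m|p]; last by exists (None, proj None p); rewrite ?inE /incident.
case: l m => [d c] [e c']; rewrite !inE /= => /eqP -> /eqP -> lm p.
by apply: contra lm => /andP[/eqP /= <- /eqP /= <-].
Qed.

End Hyperoval.

Lemma exists_gq_with_spread n : exists (s : nat) (P L : finType)
    (inc : P -> L -> bool) (S : {set L}),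
  [/\ 0 < s, n <= s, n <= #|P|, generalized_quadrangle inc s s.+2
    & spread inc S].
Proof.
(* The field of order 2^(n+1) works, as s = 2^(n+1) - 1 >= n. *)
have [F char2 cardF] := @pPrimePowerField 2 n.+1 isT isT.
have F_gt0 : 0 < #|F| by rewrite cardF expn_gt0.
have sF : #|F|.-1.+1 = #|F| by rewrite prednK.
have nF : n.+1 < #|F| by rewrite cardF ltn_expl.
exists #|F|.-1, (point F), (line F), (@incident F), (parallel_class F).
split; [lia|lia| | |exact: spread_parallel_class].
  rewrite /point !card_prod; apply: leq_trans (ltnW (ltnW nF)) _.
  by rewrite leq_pmull // muln_gt0 !F_gt0.
exact: generalized_quadrangle_hyperoval.
Qed.

(** * Distance spectrum of the infinite family *)

Theorem mainTheorem4 (C : numClosedFieldType) :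
  (forall (t : nat) (P L : finType) (inc : P -> L -> bool) (S : {set L}),
     3 <= t -> generalized_quadrangle inc (t - 2) t -> spread inc S ->
     let G := remove_spread inc S in
     [/\ distance_regular G, antipodal G, diameter G = 3
       & num_distance_eigenvalues G C 3])
  /\
  (forall N : nat, exists2 t : nat, N <= t /\ 3 <= t &
     exists (P L : finType) (inc : P -> L -> bool) (S : {set L}),
       generalized_quadrangle inc (t - 2) t /\ spread inc S)
  /\
  (forall N : nat,
     exists (t : nat) (P L : finType) (inc : P -> L -> bool) (S : {set L}),
       [/\ 3 <= t, generalized_quadrangle inc (t - 2) t, spread inc S
         & N <= #|P|] /\
       let G := remove_spread inc S in
       [/\ distance_regular G, diameter G = 3
         & num_distance_eigenvalues G C 3]).
Proof.
have main t (P L : finType) (inc : P -> L -> bool) (S : {set L}) :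
    3 <= t -> generalized_quadrangle inc (t - 2) t -> spread inc S ->
    let G := remove_spread inc S in
    [/\ distance_regular G, antipodal G, diameter G = 3
      & num_distance_eigenvalues G C 3].
  case: t => [|[|[|s]]] // _; rewrite !subSS subn0 => gq spS G; split.
  - exact: distance_regular_remove_spread gq spS _ _.
  - exact: antipodal_remove_spread gq spS _ _.
  - exact: diameter_remove_spread gq spS _ _.
  exact: num_distance_eigenvalues_remove_spread gq spS _.
split; first exact: main; split=> N.
  have [s [P [L [inc [S [s0 Ns _ gq spS]]]]]] := exists_gq_with_spread N.
  exists s.+2; first by lia.
  by exists P, L, inc, S; rewrite !subSS subn0.
have [s [P [L [inc [S [s0 _ NP gq spS]]]]]] := exists_gq_with_spread N.
have gq' : generalized_quadrangle inc (s.+2 - 2) s.+2 by rewrite !subSS subn0.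
have [|dr _ diam ev] := main _ _ _ _ _ _ gq' spS; first by [].
by exists s.+2, P, L, inc, S.
Qed.
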